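(* Let $f:\mathbb{R}^d\to\mathbb{R}$ be quadratic with constant Hessian $H$, $\sigma$-strongly convex and $L$-smooth, with minimizer $\mu_*$. Let $\mu_k\in\mathbb{R}^d$ and let $\Sigma_k$ be a symmetric positive definite $d\times d$ matrix satisfying $$\left(1-\frac{\sigma/4}{L+\sigma/4}\right)\Sigma_k^{-1}\preceq H\preceq\left(1+\frac13\right)\Sigma_k^{-1}.$$ Let $\mu_{k+1}$ be the MiNES update with batch size $b=1$ and step size $\eta_1^{(k)}=\frac{1}{2(d+2)}$, i.e. $\mu_{k+1}=\mu_k-\eta_1^{(k)}\tilde g(\mu_k)$. Then $$\mathbb{E}\left[f(\mu_{k+1})-f(\mu_* )\right]\le\left(1-\frac{1}{3(d+2)}\right)\left(f(\mu_k)-f(\mu_* )\right),$$ where the expectation is over the random direction $u$ used in $\tilde g(\mu_k)$, with $\mu_k$ and $\Sigma_k$ given.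
   Context: Fix $\alpha>0$. The MiNES search direction with batch size one is $$\tilde g(\mu_k)=\frac{f(\mu_k+\alpha\Sigma_k^{1/2}u)-f(\mu_k-\alpha\Sigma_k^{1/2}u)}{2\alpha}\,\Sigma_k^{1/2}u,\qquad u\sim N(0,I_d).$$ $L$-smooth means $\nabla f$ is $L$-Lipschitz; $\sigma$-strongly convex ($\sigma>0$) means $f(x)-f(y)\ge\langle\nabla f(y),x-y\rangle+\frac{\sigma}{2}\|x-y\|^2$ for all $x,y\in\mathbb{R}^d$. $\preceq$ is the Loewner order on symmetric matrices. *)

(* Defs.v *)
From HB Require Import structures.
From mathcomp Require Import all_boot all_order all_algebra.
From mathcomp Require Import all_classical all_reals all_analysis.

Set Implicit Arguments.
Unset Strict Implicit.
Unset Printing Implicit Defensive.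

Import Order.TTheory GRing.Theory Num.Theory.
Import numFieldNormedType.Exports.

Local Open Scope classical_set_scope.
Local Open Scope ring_scope.

(* Vectors of R^d are columns 'cV[R]_d. The library norm `|x| on matrices is
   the sup norm, hence the separate Euclidean norm; the topology, and so the
   notions of differentiability and derivative, are the same for both norms. *)

Definition dotv (R : realType) (d : nat) (x y : 'cV[R]_d) : R :=
  (x^T *m y) 0 0.

Definition enorm (R : realType) (d : nat) (x : 'cV[R]_d) : R :=
  Num.sqrt (dotv x x).

Definition posdefmx (R : realType) (d : nat) (A : 'M[R]_d) : Prop :=
  A^T = A /\ forall x : 'cV[R]_d, x != 0 -> 0 < dotv x (A *m x).

Definition possemidefmx (R : realType) (d : nat) (A : 'M[R]_d) : Prop :=
  A^T = A /\ forall x : 'cV[R]_d, 0 <= dotv x (A *m x).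

Definition loewner_le (R : realType) (d : nat) (A B : 'M[R]_d) : Prop :=
  possemidefmx (B - A).

(* S = A^{1/2}: a positive semidefinite A has exactly one positive semidefinite
   square root, so this relation determines S. *)
Definition is_sqrtmx (R : realType) (d : nat) (A S : 'M[R]_d) : Prop :=
  possemidefmx S /\ S *m S = A.

Definition grad (R : realType) (d : nat) (f : 'cV[R]_d -> R) (x : 'cV[R]_d) :
    'cV[R]_d :=
  \col_i 'D_(delta_mx i 0) f x.

Definition hessian (R : realType) (d : nat) (f : 'cV[R]_d -> R)
    (x : 'cV[R]_d) : 'M[R]_d :=
  \matrix_(i, j) 'D_(delta_mx i 0) (fun y => grad f y j 0) x.

Definition quadratic (R : realType) (d : nat) (f : 'cV[R]_d -> R) : Prop :=
  exists (A : 'M[R]_d) (b : 'cV[R]_d) (c : R),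
    forall x, f x = dotv x (A *m x) + dotv b x + c.

Definition smooth (R : realType) (d : nat) (L : R) (f : 'cV[R]_d -> R) : Prop :=
  (forall x, differentiable f x) /\
  forall x y, enorm (grad f x - grad f y) <= L * enorm (x - y).

Definition strongly_convex (R : realType) (d : nat) (sigma : R)
    (f : 'cV[R]_d -> R) : Prop :=
  [/\ 0 < sigma,
      forall x, differentiable f x &
      forall x y, f x - f y >=
        dotv (grad f y) (x - y) + sigma / 2 * enorm (x - y) ^+ 2].

Definition minimizer (R : realType) (d : nat) (f : 'cV[R]_d -> R)
    (m : 'cV[R]_d) : Prop :=
  forall x, f m <= f x.

Definition mutually_independent (R : realType) (dT : measure_display)
    (T : measurableType dT) (P : probability T R) (d : nat)
    (u : 'I_d -> {RV P >-> R}) : Prop :=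
  forall (J : {set 'I_d}) (A : 'I_d -> set R),
    (forall i, measurable (A i)) ->
    P (\bigcap_(i in [set` J]) (u i @^-1` A i)) =
      (\prod_(i in J) P (u i @^-1` A i))%E.

(* u ~ N(0, I_d), with u given by its d real components. *)
Definition standard_normal (R : realType) (dT : measure_display)
    (T : measurableType dT) (P : probability T R) (d : nat)
    (u : 'I_d -> {RV P >-> R}) : Prop :=
  mutually_independent u /\
  forall (i : 'I_d) (A : set R), measurable A ->
    distribution P (u i) A = normal_prob 0 1 A.

Definition rvec (R : realType) (dT : measure_display) (T : measurableType dT)
    (P : probability T R) (d : nat) (u : 'I_d -> {RV P >-> R}) (w : T) :
    'cV[R]_d :=
  \col_i u i w.

(* In the next two definitions S stands for Sigma^{1/2} and v for the sampled
   direction. *)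
Definition mines_direction (R : realType) (d : nat) (f : 'cV[R]_d -> R)
    (alpha : R) (S : 'M[R]_d) (mu v : 'cV[R]_d) : 'cV[R]_d :=
  ((f (mu + alpha *: (S *m v)) - f (mu - alpha *: (S *m v))) / (2 * alpha))
    *: (S *m v).

Definition mines_update (R : realType) (d : nat) (f : 'cV[R]_d -> R)
    (alpha eta : R) (S : 'M[R]_d) (mu v : 'cV[R]_d) : 'cV[R]_d :=
  mu - eta *: mines_direction f alpha S mu v.

(* Main.v *)
Require Import Defs.
From HB Require Import structures.
From mathcomp Require Import all_boot all_order all_algebra.
From mathcomp Require Import all_classical all_reals all_analysis.
From mathcomp Require Import measurable_realfun ring lra.

(** Put [e = mu - mu_star], [g = H e], [p = S g] and [q = p . u].  Since
    [H <= (4/3) Sigma^-1], i.e. [S H S <= 4/3], every sample satisfies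
      [f mu_{k+1} - f mu_star
         <= f mu - f mu_star - eta q^2 + (2/3) eta^2 q^2 |u|^2].
    For a standard Gaussian [u], [E q^2 = |p|^2] and
    [E (q^2 |u|^2) = (d + 2) |p|^2], so the right-hand side has mean
    [f mu - f mu_star - |p|^2 / (3 (d + 2))].  Finally the lower bound
    [a Sigma^-1 <= H], with [a = L / (L + sigma/4) >= 1/2], gives
    [|p|^2 = g . Sigma g >= a (e . H e) >= f mu - f mu_star].

    The moments of products of the [u_i] follow from the product rule for
    independent variables, passing from indicators to nonnegative and then to
    integrable functions one coordinate at a time.  The one-dimensional moments
    come from [(x^k phi)' = k x^(k-1) phi - x^(k+1) phi], whose integral over
    the line vanishes. *)

Set Implicit Arguments.
Unset Strict Implicit.
Unset Printing Implicit Defensive.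

Import Order.TTheory GRing.Theory Num.Theory.
Import numFieldNormedType.Exports.
Import HBSimple HBNNSimple.

Local Open Scope classical_set_scope.
Local Open Scope ring_scope.

(** * Measures with a density *)

Section density.
Local Open Scope ereal_scope.

(** The hypothesis on [nu] says that it is the image under [X] of the measure with density [W] with
    respect to [mu]; simple functions and monotone convergence on both sides carry it from sets to
    [g]. Through [integral_density] it is applied with [X] the identity, with [W] constant 1, and
    with [W] a product of independent factors. *)
Lemma ge0_integral_density d d' (T : measurableType d) (T' : measurableType d')
    (R : realType) (mu : {measure set T -> \bar R})
    (nu : {measure set T' -> \bar R}) (X : T -> T') (W : T -> R)
    (g : T' -> \bar R) :
  measurable_fun setT X -> measurable_fun setT W -> (forall x, 0 <= W x)%R ->
  (forall A, measurable A -> \int[mu]_(x in X @^-1` A) (W x)%:E = nu A) ->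
  measurable_fun setT g -> (forall y, 0 <= g y) ->
  \int[mu]_x (g (X x) * (W x)%:E) = \int[nu]_y g y.
Proof.
move=> mX mW W0 nuE mg g0.
have mWE : measurable_fun setT (EFin \o W) by exact/measurable_EFinP.
pose h := nnsfun_approx measurableT mg.
have hg y : (h n y)%:E @[n --> \oo] --> g y.
  exact: (cvg_nnsfun_approx measurableT mg (fun y _ => g0 y)).
have ndh y m n : (m <= n)%N -> (h m y <= h n y)%R.
  by move=> mn; move/lefP: (nd_nnsfun_approx measurableT mg mn); exact.
have -> : \int[nu]_y g y = limn (fun n => \int[nu]_y (h n y)%:E).
  under eq_integral => y _ do rewrite -(cvg_lim _ (hg y))//.
  apply: monotone_convergence => //.
  - by move=> n; exact/measurable_EFinP.
  - by move=> n y _; rewrite lee_fin.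
  - by move=> y _ m n mn; rewrite lee_fin ndh.
have -> : \int[mu]_x (g (X x) * (W x)%:E) =
    limn (fun n => \int[mu]_x ((h n (X x))%:E * (W x)%:E)).
  have hW x : (h n (X x))%:E * (W x)%:E @[n --> \oo] --> g (X x) * (W x)%:E.
    by apply: cvgeZr.
  under eq_integral => x _ do rewrite -(cvg_lim _ (hW x))//.
  apply: monotone_convergence => //.
  - move=> n; apply: emeasurable_funM => //.
    by apply/measurable_EFinP; exact: measurableT_comp.
  - by move=> n x _; rewrite mule_ge0 ?lee_fin.
  - by move=> x _ m n mn; rewrite lee_wpmul2r ?lee_fin// ndh.
congr (limn _); apply/funext => n.
rewrite integralT_nnsfun sintegralE.
(* Split [h n] along its level sets; on each of them the hypothesis on [nu] applies. *)
transitivity (\int[mu]_x (\sum_(y \in range (h n))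
    (y * \1_(h n @^-1` [set y]) (X x))%:E * (W x)%:E)).
  apply: eq_integral => x _; rewrite [in LHS]fimfunE -fsumEFin//.
  by rewrite ge0_mule_fsuml// => y; exact: nnfun_muleindic_ge0.
have mh y : measurable_fun [set: T]
    (fun x => (\1_(h n @^-1` [set y]) (X x))%:E : \bar R).
  by apply/measurable_EFinP; apply: measurableT_comp.
rewrite ge0_integral_fsum//; last 2 first.
- move=> y; apply: emeasurable_funM => //.
  under eq_fun do rewrite EFinM.
  by apply: emeasurable_funM.
- move=> y x _; apply: mule_ge0; last by rewrite lee_fin.
  exact: (nnfun_muleindic_ge0 (h n)).
apply: eq_fsbigr => y yh.
under eq_integral do rewrite EFinM -muleA.
rewrite ge0_integralZl//; last 3 first.
- exact: emeasurable_funM.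
- by move=> x _; rewrite mule_ge0 ?lee_fin.
- by move: yh; rewrite inE => -[t _ <-]; rewrite lee_fin.
congr (_ * _); rewrite -nuE// [RHS]integral_mkcond.
by apply: eq_integral => x _; rewrite epatch_indic muleC.
Qed.

(** As [W] is nonnegative, multiplication by it commutes with taking positive and negative parts. *)
Lemma integral_density d d' (T : measurableType d) (T' : measurableType d')
    (R : realType) (mu : {measure set T -> \bar R})
    (nu : {measure set T' -> \bar R}) (X : T -> T') (W : T -> R)
    (g : T' -> \bar R) :
  measurable_fun setT X -> measurable_fun setT W -> (forall x, 0 <= W x)%R ->
  (forall A, measurable A -> \int[mu]_(x in X @^-1` A) (W x)%:E = nu A) ->
  measurable_fun setT g ->
  \int[mu]_x (g (X x) * (W x)%:E) = \int[nu]_y g y.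
Proof.
move=> mX mW W0 nuE mg.
have dens := @ge0_integral_density _ _ _ _ _ mu nu X W _ mX mW W0 nuE.
rewrite [LHS]integralE [RHS]integralE; congr (_ - _).
- rewrite -dens//; last exact: measurable_funepos.
  by apply: eq_integral => x _; rewrite !funeposE maxe_pMl ?lee_fin// mul0e.
- rewrite -dens//; last exact: measurable_funeneg.
  apply: eq_integral => x _.
  by rewrite !funenegE maxe_pMl ?lee_fin// mul0e mulNe.
Qed.

Lemma integral_normal_prob (R : realType) (m s : R) (g : R -> \bar R) :
  measurable_fun setT g ->
  \int[normal_prob m s]_x g x =
  \int[lebesgue_measure]_x (g x * (normal_pdf m s x)%:E).
Proof.
move=> mg.
rewrite -(@integral_density _ _ _ _ _ lebesgue_measure _ id (normal_pdf m s))//.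
- exact: measurable_normal_pdf.
- by move=> x; exact: normal_pdf_ge0.
Qed.

(** The fundamental theorem of calculus on [[-n, n]] yields the increments of [F]; dominated
    convergence with bound [|f|] passes to the whole line. *)
Lemma integral_derive_eq0 (R : realType) (F f : R -> R) :
  (forall x : R, is_derive x (1%R : R) F (f x)) -> continuous f ->
  lebesgue_measure.-integrable setT (EFin \o f) ->
  (F n%:R - F (- n%:R))%R @[n --> \oo] --> 0%R ->
  \int[lebesgue_measure]_x (f x)%:E = 0.
Proof.
move=> dF cf intf F0.
pose A n : set R := `[(- n%:R)%R, n%:R]%classic.
have mf : measurable_fun setT f by exact: continuous_measurable_fun.
have mA n : measurable (A n) by exact: measurable_itv.
have lim1 : \int[lebesgue_measure]_x (((EFin \o f) \_ (A n)) x) @[n --> \oo] -->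
    \int[lebesgue_measure]_x (f x)%:E.
  apply: (@dominated_cvg _ _ _ lebesgue_measure setT _ _ _
    (fun x => `|(f x)%:E|)) => //.
  - move=> n; apply/(measurable_restrictT (EFin \o f) (mA n)).
    by apply: measurable_funTS; exact/measurable_EFinP.
  - move=> x _; apply: cvg_near_cst.
    near=> n; rewrite patchE ifT// inE /A/= in_itv/= -ler_norml.
    near: n; exact: nbhs_infty_ger.
  - exact: integrable_abse.
  - by move=> n x _; rewrite patchE; case: ifPn => _; rewrite ?abse0.
have lim2 :
    \int[lebesgue_measure]_x (((EFin \o f) \_ (A n)) x) @[n --> \oo] --> 0.
  have : (F n%:R - F (- n%:R))%:E @[n --> \oo] --> 0.
    by apply: cvg_EFin => //; exact: nearW.
  apply: cvg_trans; apply: near_eq_cvg; near=> n.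
  rewrite -integral_mkcond EFinB; apply/esym.
  have FC x : {for x, continuous F}.
    by apply: differentiable_continuous; apply/derivable1_diffP; case: (dF x).
  apply: continuous_FTC2.
  - rewrite -subr_gt0 opprK addr_gt0// ltr0n; near: n; exact: nbhs_infty_gt.
  - exact: continuous_subspaceT.
  - split; first by move=> x _; case: (dF x).
    + by apply: cvg_at_right_filter; exact: FC.
    + by apply: cvg_at_left_filter; exact: FC.
  - by move=> x _; rewrite derive1E; apply: derive_val.
exact: (cvg_unique _ lim1 lim2).
Unshelve. all: by end_near. Qed.
End density.

(** * Moments of the standard normal law *)

Section normal_moments.
Variable R : realType.
Local Notation phi := (@normal_pdf R 0 1).

Lemma normal_pdf01E x : phi x = normal_peak 1 * expR (- x ^+ 2 / 2).
Proof. by rewrite normal_pdfE ?oner_neq0// /normal_fun subr0 expr1n. Qed.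

(* Powers of [x] are absorbed by half of the exponent [-x^2/2], which leaves
   the density of standard deviation [sqrt 2]. *)
Lemma normal_moment_dominated n : exists2 C : R, 0 <= C &
  forall x, `|x| ^+ n * phi x <= C * normal_pdf 0 (Num.sqrt 2) x.
Proof.
have s20 : Num.sqrt 2 != 0 :> R by rewrite sqrtr_eq0 -ltNge.
have peak0 := normal_peak_gt0 s20.
(* Chosen so that [1 + t^(n+1) / (n+1)! <= exp t] at [t = x^2 / 4], once multiplied by [c], reads
   [c + x^(2(n+1)) <= c exp (x^2 / 4)]. *)
pose c : R := 4 ^+ n.+1 * (n.+1)`!%:R.
have c1 : 1 <= c.
  rewrite /c -natrX -natrM ler1n muln_gt0 expn_gt0/=; exact: fact_gt0.
have c0 : 0 < c by exact: lt_le_trans c1.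
exists (normal_peak 1 * c / normal_peak (Num.sqrt 2)).
  by rewrite divr_ge0 ?mulr_ge0 ?normal_peak_ge0// ltW.
move=> x; rewrite normal_pdf01E normal_pdfE// /normal_fun subr0 sqr_sqrtr//.
rewrite [leRHS]mulrA mulfVK ?gt_eqF// mulrCA -mulrA ler_wpM2l ?normal_peak_ge0//.
have -> : - x ^+ 2 / (2 *+ 2) = x ^+ 2 / 4 + (- x ^+ 2 / 2) :> R by field.
rewrite expRD mulrA ler_wpM2r ?expR_ge0//.
(* The term 1 covers [|x| <= 1], and the higher even power covers [|x| > 1]. *)
apply: (@le_trans _ _ (1 + (x ^+ 2) ^+ n.+1)).
  rewrite -real_normK ?num_real// -exprM; have [x1|x1] := leP `|x| 1.
    by rewrite (@le_trans _ _ 1)// ?exprn_ile1// lerDl exprn_ge0.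
  rewrite (@le_trans _ _ (`|x| ^+ (2 * n.+1)))// ?lerDr//.
  by rewrite ler_eXn2l// mul2n -addnn leqW// leq_addr.
have x4 : 0 <= x ^+ 2 / 4 by rewrite divr_ge0// sqr_ge0.
have /(ler_wpM2l (ltW c0)) := expR_ge1Dxn n x4.
apply: le_trans; rewrite mulrDr mulr1 lerD// expr_div_n /c.
have a0 : 4 ^+ n.+1 != 0 :> R by rewrite expf_neq0// pnatr_eq0.
have b0 : (n.+1)`!%:R != 0 :> R by rewrite pnatr_eq0 -lt0n fact_gt0.
by rewrite le_eqVlt; apply/orP; left; apply/eqP; field; rewrite a0 b0.
Qed.

Lemma integrable_normal_moment n :
  lebesgue_measure.-integrable [set: R] (fun x => (x ^+ n * phi x)%:E).
Proof.
have [C C0 CP] := normal_moment_dominated n.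
apply: (@le_integrable _ _ _ lebesgue_measure _ _ _
  (fun x => C%:E * (normal_pdf 0 (Num.sqrt 2) x)%:E)%E) => //.
- apply/measurable_EFinP; apply: measurable_funM; first exact: measurable_funX.
  exact: measurable_normal_pdf.
- move=> x _; rewrite -EFinM /= lee_fin normrM normrX.
  rewrite [`|phi x|]ger0_norm ?normal_pdf_ge0//.
  by apply: (le_trans (CP x)); exact: ler_norm.
- by apply: integrableZl => //; exact: integrable_normal_pdf.
Qed.

Lemma is_derive_normal_pdf01 (x : R) : is_derive x (1 : R) phi (- x * phi x).
Proof.
have -> : phi = normal_peak 1 *: (expR \o (2^-1 *: - (id ^+ 2 : R -> R))).
  by apply/funext => y; rewrite normal_pdf01E [- _ / _]mulrC.
have dq : is_derive x (1 : R) (2^-1 *: - (id ^+ 2 : R -> R)) (- x).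
  apply: is_derive_eq.
  by rewrite /GRing.scale /= expr1 mulr1; field.
have dE := is_derive1_comp (is_derive_expR _) dq.
apply: is_derive_eq; rewrite /= !fctE /= /GRing.scale /=; ring.
Qed.

(** At [k = 0] the truncated [k.-1] is 0 and the factor [k] kills the term, so the first moment
    vanishes. *)
Lemma integral_normal_moment_rec k :
  (\int[lebesgue_measure]_x (x ^+ k.+1 * phi x)%:E =
   k%:R%:E * \int[lebesgue_measure]_x (x ^+ k.-1 * phi x)%:E)%E.
Proof.
have intk := integrable_normal_moment.
have intk1 : lebesgue_measure.-integrable [set: R]
    (fun x => k%:R%:E * (x ^+ k.-1 * phi x)%:E)%E by exact: integrableZl.
pose f x : R := k%:R * (x ^+ k.-1 * phi x) - x ^+ k.+1 * phi x.
have fE : EFin \o f = ((fun x => k%:R%:E * (x ^+ k.-1 * phi x)%:E) \-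
    (fun x => (x ^+ k.+1 * phi x)%:E))%E.
  by apply/funext => x; rewrite /f /= EFinB EFinM.
suff f0 : (\int[lebesgue_measure]_x (f x)%:E = 0)%E.
  have fin := integrable_fin_num measurableT (intk k.+1).
  rewrite -[LHS]add0e -f0 -[in RHS](@integralZl _ _ _ lebesgue_measure)//.
  under [X in (X + _)%E]eq_integral do rewrite -[(_)%:E]/((EFin \o f) _) fE.
  by rewrite integralB// subeK.
apply: (@integral_derive_eq0 _ ((id ^+ k : R -> R) * phi)).
- move=> x; have dphi := is_derive_normal_pdf01 x.
  apply: is_derive_eq; rewrite /f /GRing.scale /= fctE /=.
  by case: (k) => [|n] /=; rewrite ?exprS; ring.
- have cphi : continuous phi by apply: continuous_normal_pdf; rewrite oner_neq0.
  move=> x; rewrite /f; apply: cvgB.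
    apply: cvgM; first exact: cvg_cst.
    by apply: cvgM; [exact: exprn_continuous|exact: cphi].
  by apply: cvgM; [exact: exprn_continuous|exact: cphi].
- by rewrite fE; exact: integrableB.
(* Boundary terms: the bounds for [k] and [k.+1] add up to control [(1 + |x|) |x^k phi|] by the
   constant [M]. At [x = n] and [x = -n] this leaves [M / (n + 1)], a multiple of [harmonic n]. *)
- have [C C0 CP] := normal_moment_dominated k.
  have [D D0 DP] := normal_moment_dominated k.+1.
  have s20 : Num.sqrt 2 != 0 :> R by rewrite sqrtr_eq0 -ltNge.
  pose M := (C + D) * normal_peak (Num.sqrt 2).
  have bound x : `|((id ^+ k : R -> R) * phi) x| <= M / (1 + `|x|).
    rewrite !fctE /= normrM normrX [`|phi x|]ger0_norm ?normal_pdf_ge0//.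
    rewrite ler_pdivlMr ?ltr_wpDr// mulrDr mulr1 mulrAC -exprSr.
    rewrite (le_trans (lerD (CP x) (DP x)))// -mulrDl ler_wpM2l ?addr_ge0//.
    exact: normal_pdf_ub.
  have harm (a : R) : a * harmonic n @[n --> \oo] --> 0%R.
    rewrite -[X in _ --> X](mulr0 a).
    by apply: cvgM; [exact: cvg_cst|exact: cvg_harmonic].
  apply: (squeeze_cvgr _ (harm (- (M + M))) (harm (M + M))).
  apply: nearW => n; rewrite mulNr -ler_norml (le_trans (ler_normB _ _))//.
  rewrite mulrDl; apply: lerD; apply: (le_trans (bound _));
    by rewrite ?normrN ger0_norm// nat1r.
Qed.

End normal_moments.

(** * Independent random variables *)

(** Extends a statement about families from the class [C0] to the larger class [C1], releasing one
    coordinate at a time. The induction runs over a list of coordinates allowed to be merely in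
    [C1], all others being in [C0]. *)
Lemma coordinatewise_ind (I : finType) (Y : Type) (C0 C1 : I -> Y -> Prop)
    (Q : (I -> Y) -> Prop) :
  (forall i g, C0 i g -> C1 i g) ->
  (forall f, (forall i, C0 i (f i)) -> Q f) ->
  (forall k f, (forall i, C1 i (f i)) ->
    (forall g, C0 k g -> Q (fun i => if i == k then g else f i)) -> Q f) ->
  forall f, (forall i, C1 i (f i)) -> Q f.
Proof.
move=> C01 Q0 Qstep.
suff Qs (s : seq I) f : (forall i, C1 i (f i)) ->
    (forall i, i \notin s -> C0 i (f i)) -> Q f.
  move=> f C1f; apply: (Qs (enum I)) => // i.
  by rewrite mem_enum.
elim: s f => [|k s IH] f C1f C0f; first by apply: Q0 => i; exact: C0f.
apply: (Qstep k) => // g C0g; apply: IH => i.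
  by case: eqP => [->|_]; [exact: C01|exact: C1f].
case: eqP => [->//|/eqP ik] iNs; apply: C0f.
by rewrite inE negb_or ik.
Qed.

Section independence.
Context {R : realType} d {T : measurableType d} {P : probability T R} {n : nat}.
Variable u : 'I_n -> {RV P >-> R}.
Hypothesis indep : mutually_independent u.

(** The integrals on the right are real-valued, hence faithful only when finite; this is why the
    classes of functions below include integrability. *)
Let product_rule (f : 'I_n -> R -> R) :=
  (\int[P]_w (\prod_i f i (u i w))%:E =
   (\prod_i \int[P]_w f i (u i w))%R%:E)%E.

Let indicator (i : 'I_n) (g : R -> R) :=
  exists2 A, measurable A & g = \1_A.

Let nonneg_integrable (i : 'I_n) (g : R -> R) :=
  [/\ measurable_fun setT g, forall x, 0 <= g x &
      P.-integrable setT (fun w => (g (u i w))%:E)].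

Let indicator_integrable i g : indicator i g -> nonneg_integrable i g.
Proof.
move=> [A mA ->]; split => //.
exact: (@integrable_indic _ _ _ P _ (measurable_funPTI (u i) mA)).
Qed.

(** The product of the indicators is the indicator of an intersection, to which independence applies
    with the full index set. *)
Let product_rule_indicator f : (forall i, indicator i (f i)) -> product_rule f.
Proof.
move=> fA.
have /choice[A AP] : forall i, exists A, measurable A /\ f i = \1_A.
  by move=> i; have [A ? ?] := fA i; exists A.
rewrite /product_rule.
have -> : (fun w => (\prod_i f i (u i w))%:E) =
    (fun w => (\1_(\bigcap_(i in [set` [set: 'I_n]%SET]) (u i @^-1` A i)) w)%:E).
  apply/funext => w; congr EFin.
  under eq_bigr => i _ do rewrite (AP i).2 indicE.
  rewrite indicE; case: (boolP (w \in _)).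
    rewrite inE => Aw; rewrite big1// => i _.
    by rewrite mem_set//; apply: Aw => /=; rewrite inE.
  rewrite notin_setE => nAw.
  have [i nAi] : exists i, ~ A i (u i w).
    by apply/existsNP => Aw; apply: nAw => i _; exact: Aw.
  by rewrite (bigD1 i)//= memNset// mul0r.
rewrite integral_indic//; last first.
  by apply: fin_bigcap_measurable => // i _; exact: measurable_funPTI (AP i).1.
rewrite setIT. apply: etrans (@indep [set: 'I_n]%SET A (fun i => (AP i).1)) _.
rewrite (big_morph EFin EFinM erefl).
apply: eq_big => [i|i _]; first by rewrite inE.
rewrite (AP i).2 /Rintegral (_ : (fun w => _) = (fun w => (\1_(u i @^-1` A i) w)%:E))//.
rewrite integral_indic//; last exact: measurable_funPTI (AP i).1.
by rewrite setIT fineK// fin_num_measure//; exact: measurable_funPTI (AP i).1.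
Qed.

(** When the factor at [k] is an indicator, the rule says that the product [W] of the other factors
    is a density whose image under [u k] is [q] times the law of [u k]. Integrating [f k] against
    this image gives the rule for [f]. *)
Let product_rule_nonneg f :
  (forall i, nonneg_integrable i (f i)) -> product_rule f.
Proof.
apply: (coordinatewise_ind indicator_integrable product_rule_indicator).
move=> {}k {}f fP kP.
pose W w := \prod_(i | i != k) f i (u i w).
pose q := \prod_(i | i != k) \int[P]_w f i (u i w).
have f0 i x : 0 <= f i x by have [] := fP i.
have q0 : 0 <= q by apply: prodr_ge0 => i _; apply: Rintegral_ge0.
have mfu i : measurable_fun setT (fun w => f i (u i w)).
  by have [mf _ _] := fP i; exact: measurableT_comp.
have mW : measurable_fun setT W.
  rewrite /W; under eq_fun do rewrite big_mkcond/=.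
  by apply: measurable_prod => i _; case: (i != k).
have WE A : measurable A ->
    (\int[P]_(w in u k @^-1` A) (W w)%:E =
     mscale (NngNum q0) (distribution P (u k)) A)%E.
  (* Use the rule with [\1_A] at coordinate [k], then separate that factor on both sides. *)
  move=> mA; have := kP _ (ex_intro2 _ _ A mA erefl).
  rewrite /product_rule [in X in _ = X -> _](bigD1 k)//= eqxx.
  rewrite [in X in _ = X -> _](eq_bigr (fun i => \int[P]_w f i (u i w)))//; last first.
    by move=> i /negbTE ->.
  under eq_integral.
    move=> w _; rewrite (bigD1 k)//= eqxx (eq_bigr (fun i => f i (u i w))); last first.
      by move=> i /negbTE ->.
    over.
  rewrite -/q EFinM => kPE.
  rewrite integral_mkcond; under eq_integral do rewrite epatch_indic -EFinM mulrC.
  rewrite [LHS]kPE muleC; congr (_ * _)%E.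
  rewrite /Rintegral (_ : (fun w => _) = (fun w => (\1_(u k @^-1` A) w)%:E))//.
  have mukA := measurable_funPTI (u k) mA.
  by rewrite integral_indic// setIT fineK// fin_num_measure.
have [mfk _ ifk] := fP k.
have := @integral_density _ _ _ _ _ P (mscale (NngNum q0) (distribution P (u k)))
  (u k) W (EFin \o f k) (measurable_funP (u k)) mW.
rewrite ge0_integral_mscale//=; last 2 first.
- exact/measurable_EFinP.
- by move=> x _; rewrite lee_fin.
rewrite ge0_integral_distribution//=; last 2 first.
- exact/measurable_EFinP.
- by move=> x; rewrite lee_fin.
move=> dens; rewrite /product_rule.
under eq_integral do rewrite (bigD1 k)//= EFinM.
rewrite dens//; last 2 first.
- by move=> w; rewrite /W prodr_ge0.
- exact/measurable_EFinP.
rewrite [in RHS](bigD1 k)//= EFinM muleC; congr (_ * _)%E.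
by rewrite /Rintegral fineK//; exact: integrable_fin_num.
Qed.

(** Both sides are linear in each factor, so [f k] is split into its positive and negative parts.
    Subtracting the two product integrals requires them to be finite, so integrability of the
    product is carried through the induction. *)
Lemma integral_prod_independent (f : 'I_n -> R -> R) :
  (forall i, measurable_fun setT (f i) /\
    P.-integrable setT (fun w => (f i (u i w))%:E)) ->
  P.-integrable setT (fun w => (\prod_i f i (u i w))%:E) /\
  (\int[P]_w (\prod_i f i (u i w))%:E =
   (\prod_i \int[P]_w f i (u i w))%R%:E)%E.
Proof.
apply: (@coordinatewise_ind _ _ nonneg_integrable
  (fun i g => measurable_fun setT g /\
    P.-integrable setT (fun w => (g (u i w))%:E))
  (fun f => P.-integrable setT (fun w => (\prod_i f i (u i w))%:E) /\
    product_rule f)).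
- by move=> i g [].
- move=> {}f fP; have fE := product_rule_nonneg fP; split=> //.
  (* For nonnegative factors the product rule itself shows that the integral of the product is
     finite. *)
  apply/integrableP; split.
    apply/measurable_EFinP; apply: measurable_prod => i _.
    by have [mf _ _] := fP i; exact: measurableT_comp.
  rewrite (eq_integral (fun w => (\prod_i f i (u i w))%:E)); last first.
    move=> w _; rewrite abse_EFin ger0_norm// prodr_ge0// => i _.
    by have [_ f0 _] := fP i.
  by rewrite fE ltry.
- move=> k {}f fP kP.
  have [mfk ifk] := fP k.
  have iabs : P.-integrable setT (fun w => `|(f k (u k w))%:E|)%E.
    exact: integrable_abse.
  pose fp x := Num.max (f k x) 0; pose fn x := Num.max (- f k x) 0.
  have fpn x : f k x = fp x - fn x.
    by rewrite /fp /fn; case: (leP (f k x) 0) => ?; case: leP => ?; lra.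
  have Cp : nonneg_integrable k fp.
    split; [exact: measurable_maxr|by move=> x; rewrite le_max lexx orbT|].
    apply: le_integrable iabs => //.
      by apply/measurable_EFinP; apply: measurableT_comp => //; exact: measurable_maxr.
    move=> w _; rewrite /= lee_fin normr_id /fp.
    by rewrite ger0_norm ?le_max ?lexx ?orbT// ge_max normr_ge0 ler_norm.
  have Cn : nonneg_integrable k fn.
    split; [|by move=> x; rewrite le_max lexx orbT|].
      by apply: measurable_maxr => //; exact: measurableT_comp.
    apply: le_integrable iabs => //.
      apply/measurable_EFinP; apply: measurableT_comp => //.
      by apply: measurable_maxr => //; exact: measurableT_comp.
    move=> w _; rewrite /= lee_fin normr_id /fn.
    by rewrite ger0_norm ?le_max ?lexx ?orbT// ge_max normr_ge0 -[in leRHS]normrN ler_norm.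
  have [ip ep] := kP _ Cp; have [iN eN] := kP _ Cn.
  have updE (g : R -> R) w :
      \prod_i (if i == k then g else f i) (u i w) =
      g (u k w) * \prod_(i | i != k) f i (u i w).
    rewrite (bigD1 k)//= eqxx; congr (_ * _).
    by apply: eq_bigr => i /negbTE ->.
  have prodE w : (\prod_i f i (u i w))%:E =
      ((\prod_i (if i == k then fp else f i) (u i w))%:E -
       (\prod_i (if i == k then fn else f i) (u i w))%:E)%E.
    by rewrite -EFinB !updE -mulrBl -fpn (bigD1 k).
  split.
    apply: (eq_integrable measurableT _ _ _ (integrableB measurableT ip iN)).
    by move=> w _; rewrite prodE.
  rewrite /product_rule; under eq_integral do rewrite prodE.
  rewrite integralB// ep eN -EFinB; congr EFin.
  have updIE (g : R -> R) : 
      \prod_i \int[P]_w (if i == k then g else f i) (u i w) =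
      (\int[P]_w g (u k w)) * \prod_(i | i != k) \int[P]_w f i (u i w).
    rewrite (bigD1 k)//= eqxx; congr (_ * _).
    by apply: eq_bigr => i /negbTE ->.
  rewrite !updIE -mulrBl [in RHS](bigD1 k)//=; congr (_ * _).
  have [_ _ ifp] := Cp; have [_ _ ifn] := Cn.
  rewrite -RintegralB//; apply: eq_Rintegral => w _ /=.
  by rewrite -fpn.
Qed.

End independence.

(** * Calculus of finite means *)

Section mean.
Context {R : realType} d {T : measurableType d}.
Variable P : probability T R.

(** Integrability is bundled with the value, so that sums and multiples combine without side
    conditions. *)
Definition has_mean (X : T -> R) (m : R) : Prop :=
  P.-integrable setT (EFin \o X) /\ (\int[P]_w (X w)%:E = m%:E)%E.

Lemma has_mean_expectation X m : has_mean X m -> ('E_P[X] = m%:E)%E.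
Proof. by case=> _; rewrite unlock. Qed.

Lemma has_mean_cst c : has_mean (cst c) c.
Proof.
split; first exact: finite_measure_integrable_cst.
by have := expectation_cst P c; rewrite unlock.
Qed.

Lemma has_meanD X Y a b :
  has_mean X a -> has_mean Y b -> has_mean (fun w => X w + Y w) (a + b).
Proof.
move=> [iX eX] [iY eY]; split; first exact: (integrableD measurableT iX iY).
by under eq_integral do rewrite EFinD; rewrite integralD// eX eY.
Qed.

Lemma has_meanZ X a c : has_mean X a -> has_mean (fun w => c * X w) (c * a).
Proof.
move=> [iX eX]; split; first exact: (integrableZl measurableT c iX).
by under eq_integral do rewrite EFinM; rewrite integralZl// eX.
Qed.

Lemma has_mean_sum (I : Type) (s : seq I) (X : I -> T -> R) (a : I -> R) :
  (forall i, has_mean (X i) (a i)) ->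
  has_mean (fun w => \sum_(i <- s) X i w) (\sum_(i <- s) a i).
Proof.
move=> Xa; elim: s => [|i s IH].
  rewrite big_nil (_ : (fun _ => _) = cst 0); first exact: has_mean_cst.
  by apply/funext => w; rewrite big_nil.
rewrite big_cons (_ : (fun _ => _) = (fun w => X i w + \sum_(j <- s) X j w)).
  exact: has_meanD.
by apply/funext => w; rewrite big_cons.
Qed.

End mean.

(** The double factorial [(n - 1)!!] for even [n] and 0 for odd [n], in the form of the two-step
    recursion satisfied by the integrals. *)
Fixpoint normal_moment (R : realType) (n : nat) : R :=
  match n with
  | 0 => 1
  | 1 => 0
  | (m.+1).+1 => (m.+1)%:R * normal_moment R m
  end.

Lemma integral_normal_moment (R : realType) n :
  (\int[lebesgue_measure]_x (x ^+ n * normal_pdf 0 1 x)%:E =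
   (normal_moment R n)%:E)%E.
Proof.
(* The recursion goes down by two, so two consecutive moments are carried along. *)
suff : (\int[lebesgue_measure]_x (x ^+ n * normal_pdf 0 1 x)%:E =
          (normal_moment R n)%:E)%E /\
       (\int[lebesgue_measure]_x (x ^+ n.+1 * normal_pdf 0 1 x)%:E =
          (normal_moment R n.+1)%:E)%E.
  by case.
elim: n => [|n [IH1 IH2]]; split => //.
- under eq_integral do rewrite expr0 mul1r.
  exact: integral_normal_pdf.
- by rewrite integral_normal_moment_rec mul0e.
- by rewrite integral_normal_moment_rec IH1.
Qed.

(** * Moments of a standard Gaussian vector *)

Section gaussian_vector.
Context {R : realType} d {T : measurableType d} {P : probability T R} {n : nat}.
Variable u : 'I_n -> {RV P >-> R}.
Hypothesis u_normal : standard_normal u.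

(** Both sides are the integral of [g] against [normal_prob 0 1]: the left one by transfer along
    [u i] with density 1, the right one by the normal density. *)
Let integral_normal_rv i (g : R -> \bar R) : measurable_fun setT g ->
  (\int[P]_w g (u i w) =
   \int[lebesgue_measure]_x (g x * (normal_pdf 0 1 x)%:E))%E.
Proof.
move=> mg; rewrite -integral_normal_prob//.
rewrite -(@integral_density _ _ _ _ _ P (normal_prob 0 1) (u i) (cst 1) g
  (measurable_funP (u i)))//.
  by apply: eq_integral => w _; rewrite mule1.
move=> A mA; rewrite -[LHS]/(\int[P]_(w in u i @^-1` A) cst 1 w)%E.
rewrite integral_cst ?mul1e; last exact: measurable_funPTI.
exact: u_normal.2.
Qed.

Lemma has_mean_normalX i k :
  has_mean P (fun w => u i w ^+ k) (normal_moment R k).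
Proof.
have mX : measurable_fun setT (fun x : R => (x ^+ k)%:E).
  by apply/measurable_EFinP; exact: measurable_funX.
split; last first.
  rewrite (integral_normal_rv i mX) -integral_normal_moment.
  by apply: eq_integral.
apply/integrableP; split.
  by apply/measurable_EFinP; apply: measurable_funX.
have /integrableP[_] := integrable_normal_moment R k.
have mabs : measurable_fun setT (fun x : R => `|(x ^+ k)%:E|%E).
  exact: measurableT_comp.
rewrite (integral_normal_rv i mabs).
congr (_ < _)%E; apply: eq_integral => x _.
by rewrite -EFinM /= normrM [`|normal_pdf _ _ _|]ger0_norm ?normal_pdf_ge0.
Qed.

Lemma has_mean_normal_monomial (e : 'I_n -> nat) :
  has_mean P (fun w => \prod_i u i w ^+ e i) (\prod_i normal_moment R (e i)).
Proof.
have [|i1 i2] := @integral_prod_independent _ _ _ _ _ u u_normal.1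
  (fun i x => x ^+ e i).
  move=> i; split; first exact: measurable_funX.
  by have [] := has_mean_normalX i (e i).
split => //; rewrite i2; congr EFin; apply: eq_bigr => i _.
by rewrite /Rintegral (has_mean_normalX i (e i)).2.
Qed.

Let prodX_eq (I : finType) (a : I -> R) i : \prod_l a l ^+ (l == i) = a i.
Proof.
by rewrite (bigD1 i)//= eqxx expr1 big1 ?mulr1// => l /negbTE ->.
Qed.

(** The exponent of [u l] counts its occurrences among [i] and [j]; if these differ, the factor at
    [i] is a first moment, hence 0. *)
Lemma has_mean_normal2 i j : has_mean P (fun w => u i w * u j w) (i == j)%:R.
Proof.
have := has_mean_normal_monomial (fun l => (l == i) + (l == j))%N.
have -> : (fun w => \prod_l u l w ^+ ((l == i) + (l == j))) =
    (fun w => u i w * u j w).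
  apply/funext => w; under eq_bigr do rewrite exprD.
  by rewrite big_split/= !prodX_eq.
congr (has_mean _ _ _); have [<-|ij] := eqVneq i j.
  by rewrite big1// => l _; case: (l == i); rewrite /= ?mulr1.
by rewrite (bigD1 i)//= eqxx (negbTE ij) /= mul0r.
Qed.

(** If [i] and [j] differ, one of them also differs from [k] and contributes a first moment. If they
    agree, the factor at [i] is the fourth moment 3 or the second moment 1, according to whether
    [i = k], and all others are 1. *)
Lemma has_mean_normal4 i j k :
  has_mean P (fun w => u i w * u j w * u k w ^+ 2)
    ((i == j)%:R * (1 + 2 * (i == k)%:R)).
Proof.
have := has_mean_normal_monomial (fun l => (l == i) + (l == j) + (l == k) * 2)%N.
have -> : (fun w => \prod_l u l w ^+ ((l == i) + (l == j) + (l == k) * 2)) =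
    (fun w => u i w * u j w * u k w ^+ 2).
  apply/funext => w; under eq_bigr do rewrite !exprD exprM.
  by rewrite !big_split/= !prodX_eq expr2.
congr (has_mean _ _ _); have [<-|ij] := eqVneq i j; last first.
  rewrite mul0r; have [<-|ik] := eqVneq i k.
    by rewrite (bigD1 j)//= eqxx eq_sym (negbTE ij) /= mul0r.
  by rewrite (bigD1 i)//= eqxx (negbTE ij) (negbTE ik) /= mul0r.
rewrite (bigD1 i)//= eqxx big1 ?mulr1 => [|l li].
  by case: (i == k); rewrite /=; ring.
by rewrite (negbTE li) /=; case: (l == k); rewrite /= ?mulr1.
Qed.

Lemma has_mean_normal_form2 (p : 'I_n -> R) :
  has_mean P (fun w => (\sum_i p i * u i w) ^+ 2) (\sum_i p i ^+ 2).
Proof.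
have := has_mean_sum (index_enum 'I_n) (fun i => has_mean_sum (index_enum 'I_n)
  (fun j => has_meanZ (p i * p j) (has_mean_normal2 i j))).
congr (has_mean _ _ _).
  apply/funext => w; rewrite expr2 mulr_suml; apply: eq_bigr => i _.
  by rewrite mulr_sumr; apply: eq_bigr => j _; ring.
apply: eq_bigr => i _; rewrite (bigD1 i)//= eqxx mulr1 big1 ?addr0// => j.
by rewrite eq_sym => /negbTE ->; rewrite mulr0.
Qed.

(** Only the terms with [i = j] survive, and summing [1 + 2 [i = k]] over [k] produces the factor
    [n + 2]. *)
Lemma has_mean_normal_form4 (p : 'I_n -> R) :
  has_mean P (fun w => (\sum_i p i * u i w) ^+ 2 * (\sum_k u k w ^+ 2))
    ((n%:R + 2) * \sum_i p i ^+ 2).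
Proof.
have := has_mean_sum (index_enum 'I_n) (fun i => has_mean_sum (index_enum 'I_n)
  (fun j => has_mean_sum (index_enum 'I_n)
  (fun k => has_meanZ (p i * p j) (has_mean_normal4 i j k)))).
congr (has_mean _ _ _).
  apply/funext => w; rewrite expr2 2!mulr_suml; apply: eq_bigr => i _.
  rewrite -mulrA mulr_suml mulr_sumr; apply: eq_bigr => j _.
  by rewrite 2!mulr_sumr; apply: eq_bigr => k _; ring.
rewrite mulr_sumr; apply: eq_bigr => i _.
rewrite (bigD1 i)//= [X in _ + X]big1 ?addr0 => [|j]; last first.
  by rewrite eq_sym => /negbTE ->; apply: big1 => k _; rewrite mul0r mulr0.
rewrite eqxx; under eq_bigr do rewrite mul1r mulrDr mulr1.
rewrite big_split/= sumr_const card_ord (bigD1 i)//= eqxx big1; last first.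
  by move=> k; rewrite eq_sym => /negbTE ->; rewrite mulr0 mulr0.
by rewrite -[_ *+ n]mulr_natl mulr1n; ring.
Qed.

End gaussian_vector.

(** * Quadratic functions and positive definite matrices *)

Section dotv_theory.
Variables (R : realType) (d : nat).
Implicit Types (x y z : 'cV[R]_d) (A : 'M[R]_d).

Lemma dotvE x y : dotv x y = \sum_i x i 0 * y i 0.
Proof. by rewrite /dotv mxE; apply: eq_bigr => i _; rewrite mxE. Qed.

Lemma dotvC x y : dotv x y = dotv y x.
Proof. by rewrite !dotvE; apply: eq_bigr => i _; rewrite mulrC. Qed.

Lemma dotvDr x y z : dotv x (y + z) = dotv x y + dotv x z.
Proof. by rewrite /dotv mulmxDr mxE. Qed.

Lemma dotvZr a x y : dotv x (a *: y) = a * dotv x y.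
Proof. by rewrite /dotv -scalemxAr mxE. Qed.

Lemma dotvNr x y : dotv x (- y) = - dotv x y.
Proof. by rewrite -scaleN1r dotvZr mulN1r. Qed.

Lemma dotvBr x y z : dotv x (y - z) = dotv x y - dotv x z.
Proof. by rewrite dotvDr dotvNr. Qed.

Lemma dotvDl x y z : dotv (x + y) z = dotv x z + dotv y z.
Proof. by rewrite dotvC dotvDr !(dotvC z). Qed.

Lemma dotvZl a x y : dotv (a *: x) y = a * dotv x y.
Proof. by rewrite dotvC dotvZr dotvC. Qed.

Lemma dotvNl x y : dotv (- x) y = - dotv x y.
Proof. by rewrite dotvC dotvNr dotvC. Qed.

Lemma dotvBl x y z : dotv (x - y) z = dotv x z - dotv y z.
Proof. by rewrite dotvDl dotvNl. Qed.

Lemma dot0v x : dotv 0 x = 0.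
Proof. by rewrite -(scale0r x) dotvZl mul0r. Qed.

Lemma dotv_mulmx A x y : dotv x (A *m y) = dotv (A^T *m x) y.
Proof. by rewrite /dotv trmx_mul trmxK mulmxA. Qed.

Lemma dotv_ge0 x : 0 <= dotv x x.
Proof. by rewrite dotvE sumr_ge0// => i _; rewrite -expr2 sqr_ge0. Qed.

Lemma dotv_eq0 x : (dotv x x == 0) = (x == 0).
Proof.
rewrite dotvE psumr_eq0; last by move=> i _; rewrite -expr2 sqr_ge0.
apply/allP/eqP => [x0|-> i _]; last by rewrite /= !mxE mulr0 eqxx.
apply/matrixP => i j; rewrite ord1 mxE.
by have /= := x0 i (mem_index_enum i); rewrite mulf_eq0 orbb => /eqP ->.
Qed.

Lemma dotv_delta x i : dotv x (delta_mx i 0) = x i 0.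
Proof.
rewrite dotvE (bigD1 i)//= mxE !eqxx mulr1 big1 ?addr0// => j /negbTE ji.
by rewrite mxE ji mulr0.
Qed.

Lemma enorm_sqr x : enorm x ^+ 2 = dotv x x.
Proof. by rewrite sqr_sqrtr// dotv_ge0. Qed.

End dotv_theory.

(** * Gradient and Hessian of a quadratic function *)

Section quadratic.
Variables (R : realType) (d : nat).
Implicit Types (x y v : 'cV[R]_d).

(** The difference quotient is [a + h b] for nonzero [h]. This serves for [f] itself and, with
    [b = 0], for the affine components of its gradient. *)
Lemma derive_quadratic (V : normedModType R) (f : V -> R) (x v : V) (a b : R) :
  (forall h, f (x + h *: v) = f x + h * a + h ^+ 2 * b) -> 'D_v f x = a.
Proof.
move=> fE; apply: cvg_lim => //.
have lin : (fun h : R => a + h * b) @ 0^' --> a + 0 * b.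
  apply: cvg_within_filter.
  by apply: cvgD; [exact: cvg_cst|apply: cvgM; [exact: cvg_id|exact: cvg_cst]].
rewrite mul0r addr0 in lin; apply: cvg_trans lin; apply: near_eq_cvg.
near=> h.
have h0 : h != 0 by near: h; exact: nbhs_dnbhs_neq.
by rewrite /= [h *: v + x]addrC fE /GRing.scale /=; field.
Unshelve. all: by end_near. Qed.

Variables (A : 'M[R]_d) (b : 'cV[R]_d) (c : R) (f : 'cV[R]_d -> R).
Hypothesis fE : forall x, f x = dotv x (A *m x) + dotv b x + c.
(** The matrix [A] is arbitrary and its form carries no factor 1/2, so the constant Hessian is
    [A + A^T]. *)
Let H := A + A^T.

Let H_sym : H^T = H.
Proof. by rewrite /H linearD /= trmxK addrC. Qed.

(** The exact Taylor formula, from which the gradient, the stationarity of minimizers and the effect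
    of an update are all read off. *)
Lemma quadratic_expand x v h :
  f (x + h *: v) =
  f x + h * dotv (H *m x + b) v + h ^+ 2 * (dotv v (H *m v) / 2).
Proof.
rewrite !fE.
have HA y z : dotv y (H *m z) = dotv y (A *m z) + dotv z (A *m y).
  by rewrite mulmxDl dotvDr (dotv_mulmx A^T) trmxK (dotvC (A *m y)).
rewrite mulmxDr -scalemxAr !dotvDl !dotvDr !dotvZl !dotvZr (dotvC (H *m x)) !HA.
by field.
Qed.

Lemma grad_quadratic x : grad f x = H *m x + b.
Proof.
apply/matrixP => i j; rewrite ord1 mxE.
rewrite (derive_quadratic (a := (H *m x + b) i 0)
  (b := dotv (delta_mx i 0) (H *m (delta_mx i 0)) / 2))//.
by move=> h; rewrite quadratic_expand dotv_delta.
Qed.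

Lemma hessian_quadratic x : hessian f x = H.
Proof.
apply/matrixP => i j; rewrite mxE.
(* Entry [(i, j)] of [hessian] differentiates component [j] of the gradient in direction [i], which
   gives [H j i]; symmetry restores the order. *)
rewrite (derive_quadratic (a := H j i) (b := 0)).
  by rewrite -[in LHS]H_sym [LHS]mxE.
move=> h; rewrite !grad_quadratic mulr0 addr0 mulmxDr -scalemxAr.
have -> : H j i = (H *m (delta_mx i 0 : 'cV_d)) j 0.
  by rewrite -colE [RHS]mxE.
by move: (H *m x) (H *m delta_mx i 0) => y z; rewrite !mxE; ring.
Qed.

End quadratic.

(** * Minimizers, curvature bounds and the update of a quadratic function *)

Section quadratic_descent.
Variables (R : realType) (d : nat).
Implicit Types (x y v e : 'cV[R]_d).

Lemma linear_coef_eq0 (a q : R) : (forall h, 0 <= h * a + h ^+ 2 * q) -> a = 0.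
Proof.
(* With [t q < 1], the test point [h = - a t] gives the value [- a^2 t (1 - t q)], which is
   nonnegative only if [a = 0]. *)
move=> aq; pose t := (`|q| + 1)^-1.
have q1 : 0 < `|q| + 1 by rewrite ltr_wpDl.
have t0 : 0 < t by rewrite invr_gt0.
have tq : t * q < 1.
  by rewrite mulrC ltr_pdivrMr// mul1r (le_lt_trans (ler_norm q))// ltrDl.
have := aq (- (a * t)).
rewrite (_ : _ + _ = - (a ^+ 2 * (t * (1 - t * q)))); last by ring.
rewrite oppr_ge0 pmulr_lle0 ?mulr_gt0 ?subr_gt0// => a2.
by apply/eqP; rewrite -sqrf_eq0 eq_le a2 sqr_ge0.
Qed.

Variables (A : 'M[R]_d) (b : 'cV[R]_d) (c : R) (f : 'cV[R]_d -> R).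
Hypothesis fE : forall x, f x = dotv x (A *m x) + dotv b x + c.
Let H := A + A^T.

(** Moving along the gradient itself, the linear coefficient of the expansion is the squared norm of
    the gradient. *)
Lemma quadratic_minimizer m : minimizer f m -> H *m m + b = 0.
Proof.
move=> fm; apply/eqP; rewrite -dotv_eq0; apply/eqP.
apply: linear_coef_eq0 => h.
have := fm (m + h *: (H *m m + b)); rewrite (quadratic_expand fE) -/H.
by rewrite -addrA lerDl; exact.
Qed.

Lemma quadratic_sub_min m x : minimizer f m ->
  f x - f m = dotv (x - m) (H *m (x - m)) / 2.
Proof.
move=> /quadratic_minimizer gm.
have := quadratic_expand fE m (x - m) 1; rewrite -/H gm scale1r [m + _]addrC subrK => ->.
by rewrite dot0v mulr0 addr0 expr1n mul1r addrC addKr.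
Qed.

(** Strong convexity bounds [H e] from below and smoothness bounds it from above. Two distinct
    points exclude dimension zero, where [sigma] and [L] are unrelated. *)
Lemma strongly_convex_le_smooth sigma L x y :
  strongly_convex sigma f -> smooth L f -> x != y -> 0 < sigma <= L.
Proof.
move=> [s0 _ sc] [_ sm] xy; rewrite s0/=.
pose e := x - y.
have e0 : 0 < dotv e e.
  by rewrite lt_neqAle eq_sym dotv_eq0 subr_eq0 xy dotv_ge0.
have gE : grad f x - grad f y = H *m e.
  by rewrite !(grad_quadratic fE) -/H mulmxBr opprD addrACA subrr addr0.
have He_ge : sigma * dotv e e <= dotv e (H *m e).
  (* Adding the two inequalities cancels the values of [f]. *)
  have := lerD (sc x y) (sc y x).
  rewrite !enorm_sqr -[y - x]opprB !dotvNr !dotvNl !opprK.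
  have -> : dotv e (H *m e) = dotv (grad f x) (x - y) - dotv (grad f y) (x - y).
    by rewrite -dotvBl gE dotvC.
  by rewrite /e => ?; lra.
have L0 : 0 <= L.
  have := le_trans (sqrtr_ge0 _) (sm x y).
  rewrite pmulr_lge0// lt_neqAle sqrtr_ge0 andbT.
  by rewrite eq_sym sqrtr_eq0 -ltNge.
have He_le : dotv (H *m e) (H *m e) <= L ^+ 2 * dotv e e.
  rewrite -!enorm_sqr -exprMn ler_sqr ?nnegrE ?mulr_ge0 ?sqrtr_ge0//.
  by have := sm x y; rewrite gE.
(* [|H e - sigma e|^2 >= 0] turns [sigma |e|^2 <= e . H e] into
   [sigma |e| <= |H e|]. *)
have CS := dotv_ge0 (H *m e - sigma *: e).
rewrite dotvBl !dotvBr !dotvZl !dotvZr (dotvC (H *m e) e) in CS.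
move: He_ge He_le CS e0 L0 s0.
move: (dotv (H *m e) (H *m e)) (dotv e (H *m e)) (dotv e e) => C B E.
move=> He_ge He_le CS E0 L0 {}s0.
have sB : sigma * (sigma * E) <= sigma * B by rewrite ler_pM2l.
have : sigma ^+ 2 * E <= L ^+ 2 * E.
  rewrite (le_trans _ He_le)// expr2 -mulrA.
  move: sB CS; move: (sigma * (sigma * E)) (sigma * B) => p q.
  by lra.
by rewrite ler_pM2r// ler_sqr ?nnegrE// ltW.
Qed.

(** The symmetric difference cancels the even part of the expansion, so the direction is exactly
    [q *: (S *m v)], with [q] the slope of [f] along [S *m v], whatever the nonzero [alpha]. The
    update is then a step [h = - eta q] along [S *m v]. *)
Lemma mines_update_expand alpha eta (S : 'M[R]_d) mu v : alpha != 0 -> S^T = S ->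
  f (mines_update f alpha eta S mu v) =
    f mu - eta * dotv (S *m (H *m mu + b)) v ^+ 2 +
    eta ^+ 2 * dotv (S *m (H *m mu + b)) v ^+ 2 *
      (dotv (S *m v) (H *m (S *m v)) / 2).
Proof.
move=> a0 Ssym; rewrite /mines_update /mines_direction.
have -> : dotv (S *m (H *m mu + b)) v = dotv (H *m mu + b) (S *m v).
  by rewrite dotv_mulmx Ssym.
set w := S *m v.
rewrite -[mu - alpha *: w]/(mu + - (alpha *: w)) -[- (alpha *: w)]scaleNr.
rewrite scalerA -scaleNr !(quadratic_expand fE) -/H.
move: (dotv (H *m mu + b) w) (dotv w _) (f mu) => q r F.
by field.
Qed.

End quadratic_descent.

(** When [H e] is a gradient, this is a gradient domination inequality in the metric of [Sigma]. *)
Lemma dual_form_lower_bound (R : realType) (d : nat) (a : R) (H Sigma : 'M[R]_d) e :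
  0 < a -> Sigma^T = Sigma -> Sigma \in unitmx ->
  (forall x, 0 <= dotv x (invmx Sigma *m x)) ->
  a * dotv e (invmx Sigma *m e) <= dotv e (H *m e) ->
  a * dotv e (H *m e) <= dotv (H *m e) (Sigma *m (H *m e)).
Proof.
move=> a0 Ss Su K0 Hle; pose g := H *m e.
(* The nonnegative quantity [(Sigma g - a e) . Sigma^-1 (Sigma g - a e)]
   expands to [g . Sigma g - 2 a (g . e) + a^2 (e . Sigma^-1 e)]. *)
have := K0 (Sigma *m g - a *: e).
rewrite mulmxBr mulKmx// -scalemxAr dotvBl !dotvBr !dotvZl !dotvZr.
rewrite (dotv_mulmx (invmx Sigma) (Sigma *m g)) trmx_inv Ss mulKmx//.
rewrite (dotvC _ g) (dotvC g e) -/g.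
move: Hle; rewrite -/g.
move: (dotv g (Sigma *m g)) (dotv e g) (dotv e (invmx Sigma *m e)) => G E Q h1 h2.
(* This absorbs one of the two cross terms: [G >= 2 a E - a^2 Q >= a E]. *)
have : a * (a * Q) <= a * E by rewrite ler_pM2l.
lra.
Qed.

(** * Positive definite matrices and their square roots *)

Section posdef.
Variables (R : realType) (d : nat).
Implicit Types (x v : 'cV[R]_d) (Sigma S : 'M[R]_d).

Lemma posdefmx_ge0 Sigma x : posdefmx Sigma -> 0 <= dotv x (Sigma *m x).
Proof.
move=> [_ pos]; have [->|/pos/ltW//] := eqVneq x 0.
by rewrite dot0v.
Qed.

Lemma posdefmx_unit Sigma : posdefmx Sigma -> Sigma \in unitmx.
Proof.
move=> [Ssym pos]; rewrite -row_free_unit; apply: inj_row_free => v vS.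
apply/eqP/negPn/negP => v0; have : v^T != 0 by rewrite trmx_eq0.
move=> /pos; rewrite -Ssym -trmx_mul vS trmx0 dotvC dot0v.
by rewrite ltxx.
Qed.

Lemma posdefmx_inv_ge0 Sigma x :
  posdefmx Sigma -> 0 <= dotv x (invmx Sigma *m x).
Proof.
move=> Spos; have Su := posdefmx_unit Spos.
rewrite -{1}(mulKVmx Su x) dotvC; exact: posdefmx_ge0.
Qed.

(** This is [S Sigma^-1 S = 1], where [S] is invertible because its square is. It turns the upper
    bound on [H] into a bound by the squared norm of the sample. *)
Lemma sqrtmx_inv_form Sigma S v : posdefmx Sigma -> is_sqrtmx Sigma S ->
  dotv (S *m v) (invmx Sigma *m (S *m v)) = dotv v v.
Proof.
move=> Spos [[Ssym _] SS]; have Sigma_unit := posdefmx_unit Spos.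
have /andP[Su _] : (S \in unitmx) && (S \in unitmx) by rewrite -unitmx_mul SS.
rewrite -{1}Ssym -dotv_mulmx; congr dotv.
by apply: (can_inj (mulKmx Su)); rewrite mulmxA SS mulKVmx.
Qed.

Lemma loewner_le_form (A B : 'M[R]_d) x :
  loewner_le A B -> dotv x (A *m x) <= dotv x (B *m x).
Proof. by move=> [_ /(_ x)]; rewrite mulmxBl dotvBr subr_ge0. Qed.

End posdef.

(** * Componentwise measurability of random vectors *)

Section measurable_cV.
Context {R : realType} d {T : measurableType d} {n : nat}.

Definition measurable_cV (V : T -> 'cV[R]_n) :=
  forall i, measurable_fun setT (fun w => V w i 0).

Lemma measurable_mulmx (A : 'M[R]_n) V :
  measurable_cV V -> measurable_cV (fun w => A *m V w).
Proof.
move=> mV i; under eq_fun do rewrite mxE.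
by apply: measurable_sum => j; exact: measurable_funM.
Qed.

Lemma measurable_dotv V W : measurable_cV V -> measurable_cV W ->
  measurable_fun setT (fun w => dotv (V w) (W w)).
Proof.
move=> mV mW; under eq_fun do rewrite dotvE.
by apply: measurable_sum => j; exact: measurable_funM.
Qed.

End measurable_cV.

Theorem theorem8 (R : realType) (d : nat) (alpha sigma L : R)
    (f : 'cV[R]_d -> R) (H Sigma S : 'M[R]_d) (mu_star mu : 'cV[R]_d)
    (dT : measure_display) (T : measurableType dT) (P : probability T R)
    (u : 'I_d -> {RV P >-> R})
    (alpha_gt0 : 0 < alpha)
    (f_quadratic : quadratic f)
    (f_hessian : forall x, hessian f x = H)
    (f_convex : strongly_convex sigma f)
    (f_smooth : smooth L f)
    (f_min : minimizer f mu_star)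
    (Sigma_posdef : posdefmx Sigma)
    (Sigma_sqrt : is_sqrtmx Sigma S)
    (H_lower : loewner_le
       ((1 - (sigma / 4) / (L + sigma / 4)) *: invmx Sigma) H)
    (H_upper : loewner_le H ((1 + 1 / 3) *: invmx Sigma))
    (u_normal : standard_normal u) :
  ('E_P[fun w => (f (mines_update f alpha (1 / (2 * (d%:R + 2))) S mu (rvec u w))
                  - f mu_star)%R]
   <= ((1 - 1 / (3 * (d%:R + 2))) * (f mu - f mu_star))%:E)%E.
Proof.
have [A [b [c fE]]] := f_quadratic.
have HE : H = A + A^T by rewrite -(f_hessian 0) (hessian_quadratic fE).
have [[Ssym _] SS] := Sigma_sqrt.
set eta := 1 / (2 * _); pose N : R := d%:R + 2.
have N0 : 0 < N by rewrite ltr_wpDl.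
pose e := mu - mu_star; pose g := H *m mu + b.
have gE : g = H *m e.
  have := quadratic_minimizer fE f_min; rewrite -HE => /eqP.
  rewrite addr_eq0 => /eqP Hm.
  by rewrite /g /e mulmxBr Hm opprK.
pose p := S *m g.
have DE : f mu - f mu_star = dotv e (H *m e) / 2.
  by rewrite (quadratic_sub_min fE _ f_min) -HE.
have ppE : dotv p p = dotv g (Sigma *m g).
  by rewrite -SS -mulmxA [RHS]dotv_mulmx Ssym.
have pp_ge : f mu - f mu_star <= dotv p p.
  (* At the minimizer the left side is 0; elsewhere there are two distinct points, which gives
     [sigma <= L]. *)
  have [e0|e0] := eqVneq mu mu_star.
    by rewrite e0 subrr dotv_ge0.
  have /andP[s0 sL] := strongly_convex_le_smooth fE f_convex f_smooth e0.
  pose a := 1 - (sigma / 4) / (L + sigma / 4).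
  (* Since [a = L / (L + sigma / 4)], this amounts to [sigma / 4 <= L]. *)
  have a_ge : 2^-1 <= a.
    have Ls : 0 < L + sigma / 4 by lra.
    have -> : a = L / (L + sigma / 4) by rewrite /a; field; lra.
    rewrite ler_pdivlMr//; lra.
  have a0 : 0 < a by apply: lt_le_trans a_ge; rewrite invr_gt0.
  have Hge0 : 0 <= dotv e (H *m e).
    have := f_min mu; rewrite -subr_ge0 DE; lra.
  (* The 1/2 in [DE] is bounded by [a], which is then the constant of the dual bound. *)
  rewrite ppE gE DE mulrC (le_trans (ler_wpM2r Hge0 a_ge))//.
  apply: (dual_form_lower_bound a0 _ (posdefmx_unit Sigma_posdef)) => [|x|].
  - exact: Sigma_posdef.1.
  - exact: posdefmx_inv_ge0.
  - have := loewner_le_form e H_lower.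
    by rewrite -scalemxAl dotvZr.
have updE w :=
  mines_update_expand fE eta mu (rvec u w) (lt0r_neq0 alpha_gt0) Ssym.
have dpE w : dotv p (rvec u w) = \sum_i p i 0 * u i w.
  by rewrite dotvE; apply: eq_bigr => i _; congr (_ * _); rewrite mxE.
(* Arranged as a constant plus multiples of the two Gaussian forms; 2/3 is half of the 4/3 in the
   upper bound on [H]. *)
pose bound w := f mu - f mu_star + ((- eta) * (\sum_i p i 0 * u i w) ^+ 2 +
  (2 / 3 * eta ^+ 2) * ((\sum_i p i 0 * u i w) ^+ 2 * (\sum_k u k w ^+ 2))).
have le_bound w :
    f (mines_update f alpha eta S mu (rvec u w)) - f mu_star <= bound w.
  rewrite updE -HE -/g -/p dpE /bound.
  set q := \sum_i _.
  have := loewner_le_form (S *m rvec u w) H_upper.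
  rewrite -scalemxAl dotvZr (sqrtmx_inv_form _ Sigma_posdef Sigma_sqrt).
  have -> : dotv (rvec u w) (rvec u w) = \sum_k u k w ^+ 2.
    by rewrite dotvE; apply: eq_bigr => i _; rewrite mxE expr2.
  move: (dotv _ _) (\sum_k _) => h s hs.
  have : eta ^+ 2 * q ^+ 2 * h <= eta ^+ 2 * q ^+ 2 * ((1 + 1 / 3) * s).
    by rewrite ler_wpM2l// mulr_ge0 ?sqr_ge0.
  lra.
have mbound := has_meanD (has_mean_cst P (f mu - f mu_star))
  (has_meanD
    (has_meanZ (- eta) (has_mean_normal_form2 u_normal (fun i => p i 0)))
    (has_meanZ (2 / 3 * eta ^+ 2)
      (has_mean_normal_form4 u_normal (fun i => p i 0)))).
have {}ppE : \sum_i p i 0 ^+ 2 = dotv p p.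
  by rewrite dotvE; apply: eq_bigr => i _; rewrite expr2.
rewrite ppE in mbound.
apply: (@le_trans _ _ ('E_P[bound])%E); last first.
  rewrite (has_mean_expectation mbound) lee_fin -/N.
  (* The coefficient of [dotv p p] becomes [- 1 / (2 N) + 1 / (6 N) = - 1 / (3 N)]. *)
  have -> : eta = (2 * N)^-1 by rewrite /eta div1r.
  have -> : f mu - f mu_star + (- (2 * N)^-1 * dotv p p +
      2 / 3 * (2 * N)^-1 ^+ 2 * (N * dotv p p)) =
      f mu - f mu_star - dotv p p / (3 * N) by field; lra.
  rewrite mulrBl !mul1r lerD2l lerN2 [leRHS]mulrC ler_wpM2l//.
  by rewrite invr_ge0 mulr_ge0// ltW.
have mu_ : measurable_cV (rvec u).
  by move=> i; under eq_fun do rewrite mxE; exact: measurable_funP.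
have mp : measurable_fun setT (fun w => dotv p (rvec u w)).
  by apply: (measurable_dotv (V := cst p)) => // i; exact: measurable_cst.
have mSu := measurable_mulmx S mu_.
(* The excess over the minimum is nonnegative, so measurability suffices to compare the two
   integrals. *)
rewrite unlock; apply: ge0_le_integral => //=.
- by move=> w _; rewrite lee_fin subr_ge0; exact: f_min.
- apply/measurable_EFinP; apply: measurable_funB => //.
  under eq_fun do rewrite updE -HE -/g -/p.
  apply: measurable_funD.
    apply: measurable_funB => //; apply: measurable_funM => //.
    exact: measurable_funX.
  apply: measurable_funM.
    by apply: measurable_funM => //; exact: measurable_funX.
  apply: measurable_funM => //; apply: measurable_dotv => //.
  exact: measurable_mulmx.
- exact: measurable_int mbound.1.
- by move=> w _; rewrite lee_fin.
Qed.
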